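(* Let $\beta$ be a quadratic Pisot number with $\beta^2=a\beta+b$, where $a,b$ are integers with $a\ge b\ge1$. Then $$\gamma(\beta)\ge\max\bigg\{0,\,1-\frac{(b-1)b\,\beta}{\beta^2-b^2}\bigg\},$$ and equality holds if $\gcd(a,b)=1$. We have $\frac{(b-1)b\,\beta}{\beta^2-b^2}<1$ if and only if $(b-1)b<a$.
   Context: A Pisot number is a real algebraic integer $\beta>1$ all of whose other Galois conjugates have absolute value less than $1$. The $\beta$-transformation is $T:[0,1)\to[0,1)$, $T(x)=\beta x-\lfloor\beta x\rfloor$. $\mathrm{Pur}(\beta)=\{x\in[0,1):T^k(x)=x\text{ for some }k\ge1\}$ is the set of numbers with purely periodic $\beta$-expansion. With $N(\beta)$ the norm of the algebraic number $\beta$, $\mathbb{Z}_{N(\beta)}=\{p/q\in\mathbb{Q}:\gcd(q,N(\beta))=1\}$, and $$\gamma(\beta)=\sup\{r\in[0,1]:\mathbb{Z}_{N(\beta)}\cap[0,r)\subseteq\mathrm{Pur}(\beta)\}.$$ *)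

(* Defs.v *)
From mathcomp Require Import all_boot all_order all_algebra complex.
From mathcomp Require Import boolp classical_sets functions cardinality fsbigop.
From mathcomp Require Import set_interval reals.

Set Implicit Arguments.
Unset Strict Implicit.
Unset Printing Implicit Defensive.

Import Order.TTheory GRing.Theory Num.Theory.

Local Open Scope classical_set_scope.
Local Open Scope ring_scope.

(* Minimal polynomial over the rationals; 0 when [x] is transcendental. *)
Definition minpolyQ (R : realType) (x : R) : {poly rat} :=
  xget 0 [set p : {poly rat} |
    [/\ p \is monic, irreducible_poly p & root (map_poly ratr p) x]].

(* Meaningful for algebraic [x] only; [x] is one of its own conjugates. *)
Definition conjugates (R : realType) (x : R) : set R[i] :=
  [set z | root (map_poly ratr (minpolyQ x)) z].

Definition algebraic_integer (R : realType) (x : R) : Prop :=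
  integralOver (intr : int -> R) x.

Definition Pisot (R : realType) (beta : R) : Prop :=
  [/\ algebraic_integer beta, 1 < beta &
      forall z : R[i], conjugates beta z -> z <> real_complex R beta ->
        `|z| < 1].

Definition quadratic (R : realType) (x : R) : Prop :=
  size (minpolyQ x) = 3%N.

(* Norm of an algebraic integer: the product of its conjugates, which is a
   rational integer. The conjugates are pairwise distinct because the minimal
   polynomial is separable, so the product can be taken over their set. *)
Definition algnorm (R : realType) (x : R) : int :=
  xget 0 [set m : int |
    m%:~R = \big[*%R/1]_(z \in conjugates x) z :> R[i]].

(* [q != 0] is not implied by coprimality when [N = 1] or [N = -1]. *)
Definition Zloc (R : realType) (N : int) : set R :=
  [set x | exists p q : int,
    [/\ q != 0, coprimez q N & x = p%:~R / q%:~R]].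

Definition beta_transf (R : realType) (beta x : R) : R :=
  beta * x - (Num.floor (beta * x))%:~R.

Definition Pur (R : realType) (beta : R) : set R :=
  [set x | 0 <= x < 1 /\
    exists2 k : nat, (0 < k)%N & iter k (beta_transf beta) x = x].

Definition gamma (R : realType) (beta : R) : R :=
  sup [set r : R | 0 <= r <= 1 /\
    Zloc (algnorm beta) `&` `[0, r[%classic `<=` Pur beta].

(* Main.v *)
Require Import Defs.
From mathcomp Require Import all_boot all_order all_algebra complex.
From mathcomp Require Import boolp classical_sets cardinality fsbigop.
From mathcomp Require Import reals.
From mathcomp Require Import ring lra zify.

(** Put t = b / beta. Then beta = a + t with 0 < t < 1, the other conjugate of
    beta is - t, and the norm of beta is - b. A rational p / q with q prime to
    b lies in the lattice (1/q) Z[beta], which the beta-transformation T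
    preserves; T acts on the conjugate of a point by x' |-> - t x' - d, where
    d is the digit, the integer part of beta x. For a lattice point z, the
    quotient (z + d) / beta is again a lattice point only when d lies in one
    residue class modulo b, determined by z. So the T-preimages of z in the
    lattice are the (z + d) / beta with d in that class and 0 <= d <= a - 1,
    the digit d = a being possible too when z < t.

    Attach to z and n an interval [lower, upper] which contains, up to an error
    of order t^n, the conjugate of z whenever z has an n-step backward orbit
    with bounded conjugates. The intervals of the preimages of z are mapped
    onto adjacent intervals (hi_contiguous), and these fill the interval of z
    exactly (digit_cover). The reason is that the lower end of z is a
    translate of the upper end at another point of the lattice (definition of
    lower), a relation which the recursion preserves (lower_rec). Hence a
    point whose conjugate lies in its n-step interval does have an n-step
    backward orbit of the same kind (back_step).

    The upper end is always at least crit = 1 - (b - 1) t / (1 - t^2), the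
    value obtained when the least allowed digit is alternately as large as
    possible and the greatest one as small as possible (upper_bounds,
    upper_worst). A rational x is its own conjugate, so if 0 <= x < crit, then
    x lies in its interval for every n and has arbitrarily long backward
    orbits inside a finite set of lattice points. Such an orbit repeats a
    point, and therefore x is purely periodic (lt_crit_Pur).

    Conversely T contracts conjugates by the factor t, so the conjugate of a
    purely periodic point exceeds its n-step upper end by at most a constant
    times t^n (Pur_le_upper). If a and b are coprime, the integers are dense
    in the beta-adic completion of Z[beta] (expand_surj). One can then find,
    in any real interval, a rational whose n-step upper end is exactly crit
    (worst_dense). Taken slightly above max(0, crit), these rationals are not
    purely periodic once n is large.

    Finally, with c = (b - 1) b, the inequality in the last claim reads
    c (beta + 1) < a beta; for integers a and c this is c < a because
    a < beta < a + 1. *)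

Set Implicit Arguments.
Unset Strict Implicit.
Unset Printing Implicit Defensive.

Import Order.TTheory GRing.Theory Num.Theory.

Local Open Scope ring_scope.

(** * Minimal polynomial, irrationality and norm *)

Lemma minpolyQP (R : realType) (x : R) : minpolyQ x != 0 ->
  [/\ minpolyQ x \is monic, irreducible_poly (minpolyQ x) &
      root (map_poly ratr (minpolyQ x)) x].
Proof. by rewrite /minpolyQ; case: xgetP => //; rewrite eqxx. Qed.

(** The minimal polynomial is irreducible, so it either divides p or is
    coprime to p; a Bezout relation evaluated at the common root excludes the
    latter. *)
Lemma minpolyQ_dvd (R : realType) (x : R) (p : {poly rat}) :
  minpolyQ x != 0 -> root (map_poly ratr p) x -> minpolyQ x %| p.
Proof.
move=> /minpolyQP[_ irr rm] rp; set m := minpolyQ x in irr rm *.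
have [cop|ncop] := boolP (coprimep m p).
  have := coprimep_map (ratr : {rmorphism rat -> R}) m p; rewrite cop.
  by move/coprimep_root => /(_ _ rm); rewrite (eqP rp) eqxx.
have := irr.2 _ ncop (dvdp_gcdl m p) => /eqp_dvdl <-.
exact: dvdp_gcdr.
Qed.

Section Quadratic.
Variables (R : realType) (beta : R) (a b : int).
Hypotheses (beta_quadratic : quadratic beta).
Hypotheses (beta_eq : beta ^+ 2 = a%:~R * beta + b%:~R).

Let minpoly_neq0 : minpolyQ beta != 0.
Proof. by rewrite -size_poly_eq0 beta_quadratic. Qed.

Lemma quadratic_irrational (m k : int) : m%:~R + k%:~R * beta = 0 -> k = 0.
Proof.
move=> e; apply/eqP/negPn/negP => k0.
pose p : {poly rat} := Poly [:: m%:~R; k%:~R].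
have k0' : k%:~R != 0 :> rat by rewrite intr_eq0.
have sp : polyseq p = [:: m%:~R; k%:~R] by apply: (@PolyK _ 0).
have rp : root (map_poly ratr p) beta.
  by rewrite rootE map_Poly horner_Poly /= !ratr_int mul0r add0r addrC e.
have /dvdp_leq := minpolyQ_dvd minpoly_neq0 rp.
by rewrite beta_quadratic -size_poly_eq0 sp => /(_ isT).
Qed.

Lemma minpolyQ_quadratic : minpolyQ beta = Poly [:: - b%:~R; - a%:~R; 1].
Proof.
set p := Poly _.
have sp : polyseq p = [:: - b%:~R; - a%:~R; 1] by apply: (@PolyK _ 0).
have rp : root (map_poly ratr p) beta.
  rewrite rootE map_Poly horner_Poly /= !rmorphN /= !ratr_int rmorph1.
  by rewrite -[X in _ == X](subrr (beta ^+ 2)) {2}beta_eq; apply/eqP; ring.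
apply/eqP; rewrite -eqp_monic; last 2 first.
- by have [] := minpolyQP minpoly_neq0.
- by rewrite monicE /lead_coef sp.
by rewrite -dvdp_size_eqp ?minpolyQ_dvd// beta_quadratic sp.
Qed.

(** Since a = beta - b / beta and b = beta (b / beta), the minimal polynomial
    factors as (z - beta) (z + b / beta) over the complex numbers. *)
Lemma conjugates_quadratic : beta != 0 -> conjugates beta =
  [set real_complex R beta; real_complex R (- (b%:~R / beta))]%classic.
Proof.
move=> b0; set u := b%:~R / beta.
have aE : a%:~R = real_complex R beta - real_complex R u :> R[i].
  rewrite -rmorphB -(rmorph_int (real_complex R)); congr (real_complex R _).
  by rewrite -[RHS](mulfK b0) mulrBl mulfVK// -expr2 beta_eq addrK mulfK.
have bE : b%:~R = real_complex R beta * real_complex R u :> R[i].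
  rewrite -rmorphM -(rmorph_int (real_complex R)); congr (real_complex R _).
  by rewrite mulrC mulfVK.
have conjP z : conjugates beta z <->
    (z - real_complex R beta) * (z + real_complex R u) = 0.
  rewrite /conjugates minpolyQ_quadratic /mkset rootE map_Poly horner_Poly /=.
  rewrite !rmorphN /= !ratr_int rmorph1 aE bE.
  by split=> [/eqP|] h; [|apply/eqP]; rewrite -[RHS]h; ring.
apply/seteqP; split=> z; rewrite /= rmorphN.
  move/conjP/eqP; rewrite mulf_eq0 subr_eq0 addr_eq0.
  by case/orP => /eqP; [left|right].
by move=> h; apply/conjP; case: h => ->; rewrite ?addNr ?subrr ?mulr0 ?mul0r.
Qed.

(** The two conjugates have opposite signs, hence are distinct, and their
    product is - b. *)
Lemma algnorm_quadratic : 0 < b -> 0 < beta -> algnorm beta = - b.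
Proof.
move=> b0 beta0; have u0 : 0 < b%:~R / beta by rewrite divr_gt0 ?ltr0z.
have prodE : (\big[*%R/1]_(z \in conjugates beta) z = (- b)%:~R :> R[i])%R.
  rewrite conjugates_quadratic ?gt_eqF// fsbigU0//=; last first.
    move=> z /= [-> /(@complexI R) e].
    by move: beta0; rewrite e oppr_gt0 => /(lt_trans u0); rewrite ltxx.
  rewrite !fsbig_set1 -rmorphM -(rmorph_int (real_complex R)).
  congr (real_complex R _).
  by rewrite mulrN mulrCA mulfV ?gt_eqF// mulr1 mulrNz.
apply: xget_unique; rewrite prodE// => m e.
by apply/eqP; rewrite -(eqr_int R[i]); apply/eqP.
Qed.
End Quadratic.

(** * Backward orbits in finite sets, and elementary bounds *)

Lemma path_iter (S X : eqType) (f : S -> X) (T : X -> X) z s :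
  path (fun u v => T (f v) == f u) z s ->
  forall m i, (i + m <= size s)%N ->
    iter m T (f (nth z (z :: s) (i + m))) = f (nth z (z :: s) i).
Proof.
move/(pathP z) => h; elim=> [|m ih] i hi; first by rewrite addn0.
rewrite iterSr addnS -[nth _ _ _.+1]/(nth z s (i + m)).
rewrite addnS in hi.
by rewrite (eqP (h _ hi)) ih// ltnW.
Qed.

(** A backward orbit of z inside a finite set repeats a point once it is long
    enough. That point is then purely periodic, and so is its forward image
    z. *)
Lemma backward_periodic (S X : eqType) (f : S -> X) (T : X -> X)
    (B : seq S) (z : S) :
  (forall n, exists s, [/\ size s = n,
     path (fun u v => T (f v) == f u) z s & {subset z :: s <= B}]) ->
  exists2 k, (0 < k)%N & iter k T (f z) = f z.
Proof.
move=> /(_ (size B))[s [sz /path_iter pth sub]].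
have /(uniqPn z)[i [j [ij js e]]] : ~~ uniq (z :: s).
  by apply/negP => /uniq_leq_size/(_ sub); rewrite /= sz ltnn.
rewrite /= ltnS in js.
exists (j - i)%N; first by rewrite subn_gt0.
have v := pth (j - i)%N i; rewrite subnKC ?(ltnW ij)// -e in v.
have w := pth i 0%N; rewrite add0n /= in w.
have is' : (i <= size s)%N by rewrite (leq_trans _ js)// ltnW.
by rewrite -w// -iterD addnC iterD v.
Qed.

Lemma mem_int_box (N : nat) (m : int) :
  `|m| < N%:Z -> m \in [seq i%:Z - N%:Z | i <- iota 0 (N + N)].
Proof.
move=> mN; apply/mapP; exists `|(m + N%:Z)%R|%N; last by lia.
by rewrite mem_iota; lia.
Qed.

(** This follows from the bound t^n (1 + n (1 - t)) <= 1, a form of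
    Bernoulli's inequality. *)
Lemma expr_lt_pos (R : realType) (t e : R) :
  0 < t -> t < 1 -> 0 < e -> exists n, t ^+ n < e.
Proof.
move=> t0 t1 e0; have u0 : 0 < 1 - t by rewrite subr_gt0.
have bernoulli n : t ^+ n * (1 + n%:R * (1 - t)) <= 1.
  elim: n => [|n ih]; first by rewrite mul0r addr0 mul1r.
  apply: le_trans ih; rewrite exprSr -mulrA ler_wpM2l ?exprn_ge0 ?(ltW t0)//.
  have nu : 0 <= n%:R * (1 - t) by rewrite mulr_ge0 ?ler0n ?(ltW u0).
  have ntu := ler_wpM2l nu (ltW t1).
  have := sqr_ge0 (1 - t); rewrite -natr1 expr2; lra.
pose n := Num.bound (e^-1 / (1 - t)); exists n.
have hn : e^-1 < n%:R * (1 - t).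
  rewrite -ltr_pdivrMr//; apply: archi_boundP.
  by rewrite divr_ge0 ?invr_ge0 ?ltW.
have d0 : 0 < 1 + n%:R * (1 - t).
  by rewrite ltr_wpDr// mulr_ge0 ?ler0n ?ltW.
rewrite -(ltr_pM2r d0) (le_lt_trans (bernoulli n))//.
by rewrite -ltr_pdivrMl// mulr1 (lt_trans hn)// ltrDr.
Qed.

(** * The lattice (1/q) Z[beta] *)

Section Lattice.
Variables (R : realType) (a b : int) (beta t : R).
Hypotheses (b_ge1 : 1 <= b) (b_le_a : b <= a).
Hypotheses (betaE : beta = a%:~R + t) (t_beta : t * beta = b%:~R).
Hypotheses (t_gt0 : 0 < t) (t_lt1 : t < 1).

Let b_gt0 : 0 < b. Proof. by lia. Qed.
Let b_neq0 : b != 0. Proof. by rewrite gt_eqF. Qed.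
Let a_ge1 : 1 <= a. Proof. exact: le_trans b_ge1 b_le_a. Qed.
Let bR_ge1 : 1 <= b%:~R :> R. Proof. by rewrite ler1z. Qed.
Let bR_le_a : b%:~R <= a%:~R :> R. Proof. by rewrite ler_int. Qed.

Let beta_ge0 : 0 <= beta.
Proof. by rewrite betaE addr_ge0 ?(ltW t_gt0)// ler0z; lia. Qed.

(** A lower bound for the upper ends defined below. It is the fixed point
    of the contraction in crit_rec, which describes two steps of the recursion
    for these upper ends, with the least favourable digits. *)
Definition crit : R := 1 - (b%:~R - 1) * t / (1 - t ^+ 2).

Lemma crit_rec : crit = 1 + t - t * (b%:~R + t - t * crit).
Proof.
have h : 1 - t ^+ 2 != 0 by rewrite gt_eqF// subr_gt0 expr_lt1// ltW.
by rewrite /crit; field.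
Qed.

Lemma crit_le1 : crit <= 1.
Proof.
rewrite /crit gerBl divr_ge0//; first by rewrite mulr_ge0 ?subr_ge0// ltW.
by rewrite subr_ge0 expr_le1// ltW.
Qed.

Variable q : int.
Hypotheses (q_neq0 : q != 0) (q_b : coprimez q b).

Let qR : q%:~R != 0 :> R. Proof. by rewrite intr_eq0. Qed.

(** The pair (m, k) stands for the lattice point (m + k beta) / q; conjv is
    the image of this point under beta |-> - t. Keeping pairs rather than
    real numbers makes the conjugate and the residues modulo b computable
    without appeal to the irrationality of beta. *)
Definition value (z : int * int) : R := (z.1%:~R + z.2%:~R * beta) / q%:~R.
Definition conjv (z : int * int) : R := (z.1%:~R - z.2%:~R * t) / q%:~R.

(** On lattice points: adding the integer d, multiplying by beta, dividing by
    beta, and the candidate (z + d) / beta for a T-preimage of z. The division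
    uses 1 / beta = (beta - a) / b and is meaningful only when b divides the
    first coordinate. *)
Definition shift (d : int) (z : int * int) : int * int := (z.1 + q * d, z.2).
Definition mulb (z : int * int) : int * int := (b * z.2, z.1 + a * z.2).
Definition divb (z : int * int) : int * int :=
  (z.2 - a * (z.1 %/ b)%Z, (z.1 %/ b)%Z).
Definition pre (d : int) (z : int * int) : int * int := divb (shift d z).

(** The integers d for which (z + d) / beta lies in the lattice; they form one
    residue class modulo b because q is prime to b. *)
Definition digit (d : int) (z : int * int) : bool := (b %| z.1 + q * d)%Z.

(** The least nonnegative digit of z. The first Bezout coefficient of (q, b)
    is an inverse of q modulo b. *)
Definition resid (z : int * int) : int := ((- z.1 * (egcdz q b).1) %% b)%Z.

Lemma resid_ge0 z : 0 <= resid z.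
Proof. exact: modz_ge0. Qed.

Lemma resid_lt z : resid z < b.
Proof. exact: ltz_pmod. Qed.

Lemma resid_digit z : digit (resid z) z.
Proof.
rewrite /digit /resid; case: egcdzP => u v; rewrite (eqP q_b) => uv _ /=.
set m := - z.1 * u; apply/dvdzP.
have := divz_eq m b; set r := (m %% b)%Z; set k := (m %/ b)%Z => e.
exists (z.1 * v - q * k).
have -> : r = m - k * b by lia.
rewrite /m; transitivity (z.1 * (u * q + v * b) - u * q * z.1 - q * k * b).
  by rewrite uv; ring.
by ring.
Qed.

Lemma digit_congr d d' z : digit d z -> digit d' z -> (b %| d - d')%Z.
Proof.
rewrite /digit => h h'.
have : (b %| q * (d - d'))%Z.
  have -> : q * (d - d') = (z.1 + q * d) - (z.1 + q * d') by ring.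
  by rewrite rpredB.
by rewrite Gauss_dvdzr // coprimez_sym.
Qed.

Lemma digit_uniq c d d' z :
  digit d z -> digit d' z -> c <= d < c + b -> c <= d' < c + b -> d = d'.
Proof.
move=> h h' cd cd'; have /dvdzP[k e] := digit_congr h h'.
have k_gt : -1 < k by rewrite -(ltr_pM2r b_gt0) -e; lia.
have k_lt : k < 1 by rewrite -(ltr_pM2r b_gt0) -e mul1r; lia.
have k0 : k = 0 by lia.
by rewrite k0 mul0r in e; lia.
Qed.

Lemma residE d z : digit d z -> 0 <= d < b -> resid z = d.
Proof.
move=> h hd; apply: (@digit_uniq 0 _ _ z) => //; first exact: resid_digit.
  by rewrite add0r resid_ge0 resid_lt.
by rewrite add0r.
Qed.

Lemma digitDb d z : digit (d + b) z = digit d z.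
Proof.
rewrite /digit.
have -> : z.1 + q * (d + b) = (z.1 + q * d) + q * b by ring.
by rewrite rpredDr ?dvdz_mull.
Qed.

Lemma preE d z c : z.1 + q * d = c * b -> pre d z = (z.2 - a * c, c).
Proof. by move=> e; rewrite /pre /divb /shift /= e mulzK. Qed.

Lemma mulb_pre d z : digit d z -> mulb (pre d z) = shift d z.
Proof.
case/dvdzP=> c e; rewrite (preE e) /mulb /shift /= e; congr pair; ring.
Qed.

Lemma pre_mulb d z : pre d (shift (- d) (mulb z)) = z.
Proof.
rewrite (@preE _ _ z.2) /shift /mulb /=; last by ring.
by case: z => m k /=; congr pair; ring.
Qed.

Lemma shiftNK d z : shift (- d) (shift d z) = z.
Proof. by case: z => m k; rewrite /shift /= mulrN addrK. Qed.

Lemma digit_mulb d z : digit d (shift (- d) (mulb z)).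
Proof. by apply/dvdzP; exists z.2; rewrite /=; ring. Qed.

Lemma value_rat p : value (p, 0) = p%:~R / q%:~R.
Proof. by rewrite /value /= mul0r addr0. Qed.

Lemma conjv_rat p : conjv (p, 0) = value (p, 0).
Proof. by rewrite value_rat /conjv /= mul0r subr0. Qed.

Lemma value_shift d z : value (shift d z) = value z + d%:~R.
Proof. by rewrite /value /shift /=; field. Qed.

Lemma conjv_shift d z : conjv (shift d z) = conjv z + d%:~R.
Proof. by rewrite /conjv /shift /=; field. Qed.

Lemma value_mulb z : value (mulb z) = beta * value z.
Proof.
rewrite /value /mulb /= mulrA; congr (_ / _).
by rewrite intrD !intrM -t_beta betaE; ring.
Qed.

Lemma conjv_mulb z : conjv (mulb z) = - t * conjv z.
Proof.
rewrite /conjv /mulb /= mulrA; congr (_ / _).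
by rewrite intrD !intrM -t_beta betaE; ring.
Qed.

(** * Intervals for the conjugates of points with long backward orbits *)

(** The lattice point z + c + a - beta. *)
Definition turn (c : int) (z : int * int) : int * int :=
  (z.1 + q * (c + a), z.2 - q).

(** The upper end of the interval of z after n steps. The recursive
    formula is upper_rec written out: the largest conjugates come from the
    least digit, and from the lower end of the corresponding preimage. The
    starting value crit makes crit a lower bound at every n. *)
Fixpoint upper n (z : int * int) : R :=
  if n is n'.+1 then
    b%:~R + t - (resid z)%:~R - t * upper n' (turn 1 (pre (resid z) z))
  else crit.

(** The lower end. The parameter c is 1 for points below t, where the digit a
    is allowed, and 0 for the other points, so that the digits range up to
    a - 1 + c in both cases. That lower ends are translates of upper
    ends is forced by the adjacency of the intervals of consecutive
    digits. *)
Definition lower (c : int) n z : R := upper n (turn c z) - c%:~R - beta.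

Lemma upper_rec n z :
  upper n.+1 z = - (resid z)%:~R - t * lower 1 n (pre (resid z) z).
Proof. by rewrite /lower /= -t_beta; ring. Qed.

(** The smallest conjugates come from the greatest digit d. The proof is a
    symmetry: if d is the greatest digit of z, then d - a + b - c is the least
    digit of the translated point turn c z. *)
Lemma lower_rec c n z d : digit d z -> a - 1 + c - b < d <= a - 1 + c ->
  lower c n.+1 z = - d%:~R - t * upper n (pre d z).
Proof.
move=> /dvdzP[k e] hd.
have e1 : (turn c z).1 + q * (d - a + b - c) = (k + q) * b.
  by rewrite /turn /= mulrDl -e; ring.
have r : resid (turn c z) = d - a + b - c.
  by apply: residE; [apply/dvdzP; exists (k + q)|lia].
rewrite /lower [upper _ _]/= r (preE e1).
have -> : turn 1 ((turn c z).2 - a * (k + q), k + q) = pre d z.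
  by rewrite (preE e) /turn /=; congr pair; ring.
by rewrite !(intrD, intrB) betaE; ring.
Qed.

(** The preimages of z for the digits d and d + b differ by
    b / beta = beta - a, exactly the translation occurring in lower. *)
Lemma contiguous n d z : digit d z ->
  lower 0 n (pre (d + b) z) = upper n (pre d z) - beta.
Proof.
case/dvdzP=> k e; rewrite /lower subr0; congr (upper n _ - _).
rewrite (preE e) (@preE _ _ (k + q)); last by rewrite mulrDl -e; ring.
by rewrite /turn /=; congr pair; ring.
Qed.

(** The image under x' |-> - t x' - d of the interval of the preimage
    (z + d) / beta, which lies below t exactly when d < b. The map reverses the
    order, so lo comes from an upper end and hi from a lower end. *)
Definition lo n d z : R := - d%:~R - t * upper n (pre d z).
Definition hi n d z : R := - d%:~R - t * lower (d < b)%R n (pre d z).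

Lemma hi_resid n z : hi n (resid z) z = upper n.+1 z.
Proof. by rewrite upper_rec /hi resid_lt. Qed.

Lemma hi_contiguous n d z : 0 <= d -> digit d z -> hi n (d + b) z = lo n d z.
Proof.
move=> d0 hd; rewrite /hi /lo; have -> : (d + b < b) = false by lia.
by rewrite contiguous// mulrBr t_beta intrD; ring.
Qed.

(** The nonnegative digits of z form the progression of step b starting at
    resid z, and the intervals of neighbours in it are adjacent; so statements
    about them propagate upwards from resid z or, in digit_ind_down, downwards
    from the greatest digit not exceeding top. *)
Lemma digit_ind_up (P : int -> Prop) z :
  P (resid z) -> (forall d, 0 <= d -> digit d z -> P d -> P (d + b)) ->
  forall d, 0 <= d -> digit d z -> P d.
Proof.
move=> P0 PS d d0 hd; have /dvdzP[k e] := digit_congr hd (resid_digit z).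
have r0 := resid_ge0 z; have rb := resid_lt z.
have k0 : -1 < k by rewrite -(ltr_pM2r b_gt0) -e; lia.
have -> : d = resid z + k * b by lia.
case: k k0 e => // k _ _ {d d0 hd}.
have dig : forall j : nat, digit (resid z + j%:Z * b) z.
  elim=> [|j ih]; first by rewrite mul0r addr0 resid_digit.
  by rewrite -addn1 PoszD mulrDl mul1r addrA digitDb.
elim: k => [|k ih]; first by rewrite mul0r addr0.
rewrite -addn1 PoszD mulrDl mul1r addrA; apply: PS => //.
by rewrite addr_ge0 ?mulr_ge0// ltW.
Qed.

Lemma digit_ind_down (P : int -> Prop) top z :
  (forall d, digit d z -> top - b < d <= top -> P d) ->
  (forall d, digit d z -> 0 <= d -> d + b <= top -> P (d + b) -> P d) ->
  forall d, 0 <= d <= top -> digit d z -> P d.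
Proof.
move=> P0 PS d; have [m] := ubnP `|top - d|%N.
elim: m d => // m ih d hm hd dig.
have [db|db] := lerP (d + b) top; last by apply: P0 => //; lia.
apply: PS => //; first by lia.
by apply: ih; rewrite ?digitDb//; lia.
Qed.

Lemma digit_window c z : exists2 d, digit d z & c - b < d <= c.
Proof.
have r := resid_digit z; have := divz_eq (c - resid z) b.
set k := (_ %/ b)%Z; set m := (_ %% b)%Z => e.
have m0 : 0 <= m by apply: modz_ge0.
have mb : m < b by apply: ltz_pmod.
exists (c - m); last by lia.
have -> : c - m = resid z + k * b by lia.
rewrite /digit mulrDr addrA rpredDr//.
by rewrite mulrA dvdz_mull.
Qed.

Lemma hi_le_upper n z :
  (forall d, lo n d z <= hi n d z) ->
  forall d, 0 <= d -> digit d z -> hi n d z <= upper n.+1 z.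
Proof.
move=> lohi; apply: digit_ind_up => [|d d0 dig]; first by rewrite hi_resid.
by rewrite hi_contiguous//; apply: le_trans.
Qed.

Lemma lower_le_lo (c : bool) n z :
  (forall d, lo n d z <= hi n d z) ->
  forall d, 0 <= d <= a - 1 + c -> digit d z -> lower c n.+1 z <= lo n d z.
Proof.
move=> lohi; apply: digit_ind_down => d dig; first by move/(lower_rec n dig)->.
move=> d0 _ h; rewrite -(hi_contiguous n d0 dig).
exact: le_trans h (lohi _).
Qed.

(** The intervals of the digits of z are adjacent and span the interval of
    z; so the latter is nonempty as soon as they are, which is the induction
    hypothesis. *)
Lemma lower_le_upper (c : bool) n z : lower c n z <= upper n z.
Proof.
elim: n c z => [|n ih] c z.
  rewrite /lower /= -addrA gerDl -opprD oppr_le0 addr_ge0//.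
have lohi d : lo n d z <= hi n d z.
  by rewrite /lo /hi lerD2l lerN2 ler_wpM2l// ltW.
have [d dig dtop] := digit_window (a - 1 + c) z.
have d0 : 0 <= d <= a - 1 + c by lia.
have d1 : 0 <= d by lia.
apply: (le_trans (lower_le_lo lohi d0 dig)).
exact: (le_trans (lohi d) (hi_le_upper lohi d1 dig)).
Qed.

Lemma lo_le_hi n d z : lo n d z <= hi n d z.
Proof. by rewrite /lo /hi lerD2l lerN2 ler_wpM2l ?lower_le_upper// ltW. Qed.

(** As the digit grows, the intervals move down, each one starting where the
    previous one ends. So the first digit whose lo is at most x will do, and
    there is one because lo at the greatest digit is the lower end of z. *)
Lemma digit_cover (c : bool) n z x : lower c n.+1 z <= x <= upper n.+1 z ->
  exists d, [/\ digit d z, 0 <= d <= a - 1 + c & lo n d z <= x <= hi n d z].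
Proof.
case/andP=> xl; rewrite -hi_resid.
have : 0 <= resid z <= a - 1 + c.
  by have := resid_ge0 z; have := resid_lt z; lia.
move=> hr; move: (resid z) hr (resid_digit z).
apply: (@digit_ind_down _ _ z) => d dig.
  move=> dtop xh; exists d; rewrite xh /lo -(lower_rec n dig dtop) xl.
  by split => //; clear -dtop b_le_a; lia.
move=> d0 dtop; have [lox _ xh|xlo ih _] := lerP (lo n d z) x.
  by exists d; split => //; [clear -d0 dtop b_ge1; lia|rewrite lox].
by apply: ih; rewrite hi_contiguous// ltW.
Qed.

(** The least digit lies between 0 and b - 1; the two bounds are exchanged by
    the recursion with these extreme digits, by crit_rec. *)
Lemma upper_bounds n z : crit <= upper n z <= b%:~R + t - t * crit.
Proof.
elim: n z => [|n ih] z.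
  have : t * crit <= t * 1 by rewrite ler_wpM2l ?crit_le1// ltW.
  by move: crit_le1 bR_ge1; rewrite lexx /=; lra.
have r0 : 0 <= (resid z)%:~R :> R by rewrite ler0z resid_ge0.
have rb : (resid z)%:~R <= b%:~R - 1 :> R.
  by rewrite -(intrB _ b 1) ler_int; have := resid_lt z; lia.
rewrite /=; have := crit_rec.
case/andP: (ih (turn 1 (pre (resid z) z))); set u := upper n _; set r := _%:~R.
move=> u1 u2 e.
have : t * crit <= t * u by rewrite ler_wpM2l// ltW.
have : t * u <= t * (b%:~R + t - t * crit) by rewrite ler_wpM2l// ltW.
by move: r0 rb; rewrite -/r; lra.
Qed.

(** * One step of the beta-transformation, backward and forward *)

(** Points below t = b / beta are those followed by a digit less than b; only
    they may be preceded by the digit a. *)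
Definition low z := value z < t.

Definition tile n z := [&& 0 <= value z < 1,
  lower (low z) n z <= conjv z & conjv z <= upper n z].

Let beta_gt0 : 0 < beta.
Proof. by rewrite betaE ltr_wpDl// ler0z; lia. Qed.

Lemma value_pre d z : digit d z -> beta * value (pre d z) = value z + d%:~R.
Proof. by move=> h; rewrite -value_mulb mulb_pre// value_shift. Qed.

Lemma conjv_pre d z : digit d z -> - t * conjv (pre d z) = conjv z + d%:~R.
Proof. by move=> h; rewrite -conjv_mulb mulb_pre// conjv_shift. Qed.

Lemma low_pre d z : 0 <= value z < 1 -> digit d z -> low (pre d z) = (d < b).
Proof.
move=> /andP[v0 v1] dig; rewrite /low -(ltr_pM2l beta_gt0) value_pre//.
rewrite [beta * t]mulrC t_beta; apply/idP/idP => [h|].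
  rewrite -(ltr_int R); lra.
rewrite -lezD1 -(ler_int R) intrD; lra.
Qed.

(** The digit found by digit_cover gives a preimage whose conjugate has the
    required position; the bound on this digit keeps the preimage below 1. *)
Lemma back_step n z : tile n.+1 z ->
  exists2 w, tile n w & beta_transf beta (value w) = value z.
Proof.
case/and3P=> /[dup] v01 /andP[v0 v1] cl cu.
have [d [dig /andP[d0 dtop] /andP[dl dh]]] :=
  digit_cover (introT andP (conj cl cu)).
have vw := value_pre dig; have cw := conjv_pre dig.
exists (pre d z).
  have d0R : 0 <= d%:~R :> R by rewrite ler0z.
  have dR : d%:~R <= a%:~R - 1 + (low z)%:R :> R.
    by move: dtop; rewrite -(ler_int R) intrD intrB.
  apply/and3P; split.
  - apply/andP; split; first by rewrite -(pmulr_rge0 _ beta_gt0) vw addr_ge0.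
    rewrite -(ltr_pM2l beta_gt0) vw mulr1 betaE; move: dR; rewrite /low.
    by move: t_gt0 v1; case: (ltP (value z) t) => /= h; lra.
  - rewrite low_pre// -(ler_pM2l t_gt0); move: dh; rewrite /hi; lra.
  - rewrite -(ler_pM2l t_gt0); move: dl; rewrite /lo; lra.
rewrite /beta_transf vw (@floor_def _ _ d); first by rewrite addrK.
by rewrite intrD; lra.
Qed.

Definition step w := shift (- Num.floor (beta * value w)) (mulb w).

Lemma value_step w : value (step w) = beta_transf beta (value w).
Proof. by rewrite value_shift value_mulb mulrNz. Qed.

Lemma conjv_step w :
  conjv (step w) = - t * conjv w - (Num.floor (beta * value w))%:~R.
Proof. by rewrite conjv_shift conjv_mulb mulrNz. Qed.

Lemma value_step_itv w : 0 <= value (step w) < 1.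
Proof.
rewrite value_step /beta_transf.
by have := floor_itv (beta * value w); rewrite intrD => /andP[]; lra.
Qed.

(** A point within distance e of its interval is mapped within distance t e of
    the interval of one of the digits of its image, hence of the interval of
    that image. *)
Lemma forth_step n w e : 0 <= value w < 1 ->
  lower (low w) n w - e <= conjv w <= upper n w + e ->
  lower (low (step w)) n.+1 (step w) - t * e <= conjv (step w)
    <= upper n.+1 (step w) + t * e.
Proof.
move=> /andP[v0 v1] /andP[cl cu].
have v01 := value_step_itv w; have := conjv_step w; have := value_step w.
rewrite /beta_transf; set d := Num.floor _ => ve ce.
have dig : digit d (step w) by exact: digit_mulb.
have prew : pre d (step w) = w by exact: pre_mulb.
have bv : beta * value w < a%:~R + t by rewrite -betaE gtr_pMr.
have d0 : 0 <= d by rewrite floor_ge0 mulr_ge0 // ltW.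
have dtop : d <= a - 1 + low (step w).
  rewrite -ltzD1 -(ltr_int R) !intrD intrN /low.
  move: t_lt1 v01; case: (ltP (value (step w)) t) => /= h t1 /andP[h3 h4];
  rewrite ?mulr1z ?mulr0z; lra.
have lw : low w = (d < b) by rewrite -{1}prew low_pre.
have hiu := hi_le_upper (fun d => lo_le_hi n d _) d0 dig.
have llo : lower (low (step w)) n.+1 (step w) <= lo n d (step w).
  by apply: lower_le_lo => // [d'|]; [exact: lo_le_hi|rewrite d0].
move: hiu llo; rewrite /hi /lo prew -lw ce => hiu llo.
have := ler_wpM2l (ltW t_gt0) cl; have := ler_wpM2l (ltW t_gt0) cu.
by move=> h1 h2; apply/andP; split; lra.
Qed.

(** The coordinates of a lattice point are linear combinations of the
    point and its conjugate. *)
Lemma bounded_finite C : 0 <= C -> exists B : seq (int * int), forall z,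
  `|value z| <= 1 -> `|conjv z| <= C -> z \in B.
Proof.
move=> C0; pose K := `|q%:~R| * (1 + C) * (1 + beta).
have K0 : 0 <= K by rewrite !mulr_ge0// addr_ge0.
pose N := Num.bound K.
have KN : K < N%:R by apply: archi_boundP.
pose I := [seq i%:Z - N%:Z | i <- iota 0 (N + N)].
exists [seq (x, y) | x <- I, y <- I] => z v1 c1.
have inI (m : int) : `|m%:~R| <= K -> m \in I.
  move=> mK; have : `|m%:~R| < N%:~R :> R by apply: le_lt_trans KN.
  by rewrite -intr_norm ltr_int => /mem_int_box.
have e2 : z.2%:~R * (beta + t) = q%:~R * (value z - conjv z).
  by rewrite /value /conjv; field.
have e1 : z.1%:~R = q%:~R * value z - z.2%:~R * beta.
  by rewrite /value; field.
have bt : 1 <= beta + t.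
  have : 1 <= a%:~R :> R by rewrite ler1z.
  by move: t_gt0; rewrite betaE; lra.
have z2K : `|z.2%:~R| <= `|q%:~R| * (1 + C) :> R.
  have vc : `|value z - conjv z| <= 1 + C.
    by rewrite (le_trans (ler_normB _ _))// lerD.
  rewrite (@le_trans _ _ `|z.2%:~R * (beta + t)|)//.
    by rewrite normrM ler_peMr// ger0_norm// (le_trans _ bt).
  by rewrite e2 normrM ler_wpM2l.
have zE : z = (z.1, z.2) by case: (z).
rewrite zE; apply/allpairsP; exists (z.1, z.2); split => //=; apply: inI.
  rewrite e1 (le_trans (ler_normB _ _))// (normrM q%:~R) (normrM z.2%:~R).
  rewrite (ger0_norm beta_ge0).
  have h1 : `|q%:~R| * `|value z| <= `|q%:~R| * (1 + C) :> R.
    by rewrite ler_wpM2l// (le_trans v1)// lerDl.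
  have h2 := ler_wpM2r beta_ge0 z2K.
  by rewrite /K mulrDr mulr1; exact: lerD h1 h2.
by rewrite (le_trans z2K)// /K ler_peMr// ?lerDl// mulr_ge0// addr_ge0.
Qed.

Lemma low_int z : 0 <= (Posz (low z))%:~R :> R.
Proof. by rewrite ler0z. Qed.

Lemma tile_bounded n z : tile n z ->
  `|value z| <= 1 /\
  `|conjv z| <= `|crit - 1 - beta| + `|b%:~R + t - t * crit|.
Proof.
case/and3P=> /andP[v0 v1] cl cu; split; first by rewrite ger0_norm// ltW.
case/andP: (upper_bounds n z) => _ u.
case/andP: (upper_bounds n (turn (low z) z)) => u' _.
have lowz : (Posz (low z))%:~R <= 1 :> R by rewrite lerz1; case: (low z).
move: cl; rewrite /lower => cl.
have := ler_norm (b%:~R + t - t * crit); have := ler_norm (- (crit - 1 - beta)).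
have := normr_ge0 (b%:~R + t - t * crit); have := normr_ge0 (crit - 1 - beta).
by rewrite normrN ler_norml => n1 n2 n3 n4; apply/andP; split; lra.
Qed.

Lemma tile_path (B : seq (int * int)) n z :
  (forall m w, tile m w -> w \in B) -> tile n z ->
  exists s, [/\ size s = n,
    path (fun u v => beta_transf beta (value v) == value u) z s &
    {subset z :: s <= B}].
Proof.
move=> tB; elim: n z => [|n ih] z tz.
  by exists [::]; split=> // w; rewrite inE => /eqP ->; apply: tB tz.
have [w /ih[s [sz pth sub]] e] := back_step tz.
exists (w :: s); split; [by rewrite /= sz|by rewrite /= e eqxx|].
by move=> v; rewrite inE => /predU1P[->|/sub//]; apply: tB tz.
Qed.

(** A rational below crit is its own conjugate and stays below every upper
    end, while the lower ends are nonpositive; so it belongs to all its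
    intervals. *)
Lemma lt_crit_Pur p : 0 <= value (p, 0) -> value (p, 0) < crit ->
  Pur beta (value (p, 0)).
Proof.
move=> v0 vc; have v1 : value (p, 0) < 1 := lt_le_trans vc crit_le1.
split; first by rewrite v0.
have tz n : tile n (p, 0).
  apply/and3P; split; rewrite ?conjv_rat ?v0//; last first.
    by case/andP: (upper_bounds n (p, 0)) => u _; apply/ltW/(lt_le_trans _ u).
  apply: le_trans (v0); rewrite /lower.
  case/andP: (upper_bounds n (turn (low (p, 0)) (p, 0))) => _ u.
  have tc : 0 <= t * crit.
    by rewrite mulr_ge0 ?(ltW t_gt0)// ltW// (le_lt_trans v0).
  (* the lower end is at most b - a - t * crit *)
  by move: (low_int (p, 0)) bR_le_a u tc; rewrite betaE; lra.
have [|B hB] := @bounded_finite (`|crit - 1 - beta| + `|b%:~R + t - t * crit|).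
  by rewrite addr_ge0.
apply: (@backward_periodic _ _ value _ B) => n; apply: tile_path (tz n).
by move=> m w /tile_bounded[]; apply: hB.
Qed.

(** * Rationals with the least favourable digits *)

(** The lattice points whose successive digits modulo powers of beta are ds:
    expand ds z = beta^n z - (d_0 + d_1 beta + ... + d_(n-1) beta^(n-1)). *)
Definition expand (ds : seq int) (z : int * int) : int * int :=
  foldr (fun d w => shift (- d) (mulb w)) z ds.

(** The largest possible least digit is b - 1, and the smallest possible
    greatest digit, for points below t, is a - b + 1. *)
Definition worst_digits n := flatten (nseq n [:: b - 1; a - b + 1]).

Lemma size_worst_digits n : size (worst_digits n) = n.*2.
Proof. by elim: n => //= n ->; rewrite doubleS. Qed.

(** With these digits two steps of the recursion for upper are exactly the
    recursion of which crit is the fixed point. *)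
Lemma upper_worst n z : upper n.*2 (expand (worst_digits n) z) = crit.
Proof.
elim: n => [//|n]; set w := expand (worst_digits n) z => ih.
set w1 := shift (- (a - b + 1)) (mulb w).
rewrite (_ : expand _ z = shift (- (b - 1)) (mulb w1))//; set w2 := shift _ _.
have r : resid w2 = b - 1 by apply: residE; [exact: digit_mulb|lia].
rewrite doubleS upper_rec r pre_mulb.
rewrite (@lower_rec _ _ _ (a - b + 1)); last 2 first.
- exact: digit_mulb.
- by lia.
rewrite pre_mulb ih [RHS]crit_rec !intrD !intrN -t_beta betaE; ring.
Qed.

(** Multiplication by beta - a, the cofactor of beta in b = beta (beta - a).
    It turns a multiple of b^n into an explicit multiple of beta^n. *)
Definition cmulb (z : int * int) : int * int := (b * z.2 - a * z.1, z.1).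

Lemma mulbD z w : mulb (z + w) = mulb z + mulb w.
Proof. by rewrite /mulb /=; congr pair; rewrite /=; ring. Qed.

Lemma expandD ds z w :
  expand ds (z + w) = expand ds z + iter (size ds) mulb w.
Proof.
elim: ds => //= d ds ->; rewrite mulbD /shift.
by congr pair; rewrite /=; ring.
Qed.

Lemma iter_mulb_cmulb n z :
  iter n mulb (iter n cmulb z) = (b ^+ n * z.1, b ^+ n * z.2).
Proof.
elim: n z => [|n ih] z; first by rewrite !mul1r; case: z.
rewrite (iterSr _ cmulb) iterS ih /mulb /cmulb /= exprS.
by congr pair; ring.
Qed.

(** Modulo beta, the factor beta - a is - a, a unit modulo b when a and b are
    coprime. *)
Lemma cmulb_mod n z : exists k, (iter n cmulb z).1 = (- a) ^+ n * z.1 + b * k.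
Proof.
elim: n => [|n [k e]]; first by exists 0; rewrite mul1r mulr0 addr0.
exists ((iter n cmulb z).2 - a * k).
by rewrite iterS [LHS]/= e exprS; ring.
Qed.

Lemma expand_shift ds m z j : expand ds z = (m, 0) ->
  expand ds (z + iter (size ds) cmulb (j, 0)) = (m + b ^+ size ds * j, 0).
Proof.
move=> e; rewrite expandD e iter_mulb_cmulb /=.
by congr pair; rewrite /= mulr0 addr0.
Qed.

(** Density of the integers in the beta-adic completion. If an integer
    has the digits ds, followed by a remainder e, then adding j b^n to it adds
    j (beta - a)^n to e; as this is congruent to j (- a)^n modulo beta, a
    suitable j produces any prescribed next digit. *)
Lemma expand_surj ds : coprimez a b -> exists m z, expand ds z = (m, 0).
Proof.
move=> ab; elim/last_ind: ds => [|ds d [m [e he]]]; first by exists 0, (0, 0).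
set N := size ds.
have cop : coprimez ((- a) ^+ N) b by rewrite coprimezXl// coprimeNz.
have /coprimezP[[u v] /= uv] := cop.
pose j := - (e.1 + q * d) * u; pose y := e + iter N cmulb (j, 0).
have dig : digit d y.
  have [k ek] := cmulb_mod N (j, 0).
  apply/dvdzP; exists ((e.1 + q * d) * v + k); rewrite /y /= ek /= /j.
  transitivity ((e.1 + q * d) * (1 - u * (- a) ^+ N) + b * k); first by ring.
  by rewrite -uv; ring.
exists (m + b ^+ N * j), (pre d y).
rewrite /expand foldr_rcons -/(expand _ _) mulb_pre//.
rewrite shiftNK; exact: expand_shift.
Qed.

(** Adding multiples of b^(2n) to the numerator does not change the first 2n
    digits, so the rationals of denominator q with the worst digits are
    spaced by b^(2n) / q. *)
Lemma worst_dense n s1 s2 : coprimez a b -> 0 < q ->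
  (b%:~R) ^+ n.*2 < q%:~R * (s2 - s1) ->
  exists m, upper n.*2 (m, 0) = crit /\ s1 < value (m, 0) < s2.
Proof.
move=> ab q0 hs; have [m [z e]] := expand_surj (worst_digits n) ab.
pose B : R := b%:~R ^+ n.*2.
have B0 : 0 < B by rewrite exprn_gt0// ltr0z.
pose j := Num.floor ((q%:~R * s1 - m%:~R) / B) + 1.
have qR0 : 0 < q%:~R :> R by rewrite ltr0z.
exists (m + b ^+ n.*2 * j); split.
  rewrite -(size_worst_digits n) -(expand_shift j e) size_worst_digits.
  exact: upper_worst.
have := floor_itv ((q%:~R * s1 - m%:~R) / B).
rewrite -/j ler_pdivlMr// ltr_pdivrMr// => /andP[f1 f2].
have jE : (Num.floor ((q%:~R * s1 - m%:~R) / B))%:~R = j%:~R - 1 :> R.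
  by rewrite /j intrD addrK.
rewrite jE in f1.
have -> : value (m + b ^+ n.*2 * j, 0) = (m%:~R + B * j%:~R) / q%:~R.
  by rewrite value_rat intrD intrM rmorphXn.
rewrite ltr_pdivlMr// ltr_pdivrMr//; move: hs; rewrite -/B => hs.
by apply/andP; split; lra.
Qed.

(** * An upper bound for purely periodic rationals *)

Hypothesis irr : forall m k : int, m%:~R + k%:~R * beta = 0 -> k = 0.

Lemma value_inj : injective value.
Proof.
move=> [m k] [m' k'] /(mulIf (invr_neq0 qR)) /= e.
have k0 : k - k' = 0.
  by apply: (@irr (m - m')); rewrite !intrB; move: e; lra.
have kk : k = k' by lia.
rewrite kk in e *; move/addIr: e => /eqP; rewrite eqr_int => /eqP ->//.
Qed.

(** A bound for conjugates that is stable under x' |-> - t x' - d with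
    0 <= d <= a, and large enough to hold for rationals in [0, 1). *)
Definition orbit_bound : R := a%:~R / (1 - t) + 1.

Lemma orbit_boundE : t * orbit_bound + a%:~R <= orbit_bound.
Proof.
have h : 1 - t != 0 by rewrite subr_eq0 gt_eqF.
have -> : t * orbit_bound + a%:~R = orbit_bound - (1 - t).
  by rewrite /orbit_bound; field.
by rewrite gerBl subr_ge0 ltW.
Qed.

Lemma step_bounded w : 0 <= value w < 1 ->
  `|conjv w| <= orbit_bound -> `|conjv (step w)| <= orbit_bound.
Proof.
move=> /andP[v0 v1] c; apply: le_trans orbit_boundE.
have bv : beta * value w < a%:~R + t by rewrite -betaE gtr_pMr.
have d0 : 0 <= Num.floor (beta * value w) by rewrite floor_ge0 mulr_ge0.
have da : Num.floor (beta * value w) <= a.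
  have /andP[f _] := floor_itv (beta * value w).
  by rewrite -ltzD1 -(ltr_int R) intrD; move: t_lt1; lra.
rewrite conjv_step (le_trans (ler_normB _ _))// lerD//.
  by rewrite normrM normrN (gtr0_norm t_gt0) ler_wpM2l// ltW.
by rewrite ger0_norm ?ler0z// ler_int.
Qed.

Lemma iter_step_value j w :
  value (iter j step w) = iter j (beta_transf beta) (value w).
Proof. by elim: j => //= j <-; rewrite value_step. Qed.

Lemma iter_step_bounded j w : 0 <= value w < 1 ->
  `|conjv w| <= orbit_bound ->
  0 <= value (iter j step w) < 1 /\ `|conjv (iter j step w)| <= orbit_bound.
Proof.
move=> v c; elim: j => //= j [vj cj].
by split; [exact: value_step_itv|exact: step_bounded].
Qed.

Lemma forth_iter n w : 0 <= value w < 1 -> `|conjv w| <= orbit_bound ->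
  conjv (iter n step w)
    <= upper n (iter n step w) + t ^+ n * (orbit_bound + `|crit|).
Proof.
move=> v c; set e := orbit_bound + _.
suff : lower (low (iter n step w)) n (iter n step w) - t ^+ n * e
    <= conjv (iter n step w) <= upper n (iter n step w) + t ^+ n * e.
  by case/andP.
elim: n => [|n ih].
  rewrite /= mul1r /lower /= /e; move: c beta_ge0 (low_int w).
  rewrite ler_norml => /andP[c1 c2] b0 l0.
  have := ler_norm crit; have := ler_norm (- crit); rewrite normrN => n1 n2.
  by apply/andP; split; lra.
rewrite exprS -mulrA [iter _ _ _]/=; apply: forth_step => //.
by have [] := iter_step_bounded n v c.
Qed.

(** A periodic point is its own image under T^n of a point of its
    orbit. Going n steps forward from there, the initial distance to the
    interval, bounded uniformly in q and n, is multiplied by t^n. *)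
Lemma Pur_le_upper p n : Pur beta (value (p, 0)) ->
  value (p, 0) <= upper n (p, 0) + t ^+ n * (orbit_bound + `|crit|).
Proof.
case=> v01 [k k0 ek].
have c : `|conjv (p, 0)| <= orbit_bound.
  case/andP: v01 => v0 v1; rewrite conjv_rat ger0_norm// (le_trans (ltW v1))//.
  by rewrite lerDr divr_ge0 ?ler0z ?subr_ge0 ?(ltW t_lt1)//; lia.
have per : iter k step (p, 0) = (p, 0).
  by apply: value_inj; rewrite iter_step_value.
have pern : iter (n * k) step (p, 0) = (p, 0).
  by elim: n => //= n ih; rewrite mulSn iterD ih.
rewrite -[X in X <= _]conjv_rat -pern -(@subnKC n (n * k)) ?leq_pmulr// iterD.
have [v' c'] := iter_step_bounded (n * k - n) v01 c.
exact: forth_iter.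
Qed.

End Lattice.

(** * The value of gamma *)

Theorem theorem6 (R : realType) (beta : R) (a b : int)
    (beta_pisot : Pisot beta) (beta_quadratic : quadratic beta)
    (beta_eq : beta ^+ 2 = a%:~R * beta + b%:~R)
    (b_ge1 : 1 <= b) (b_le_a : b <= a) :
  [/\ Num.max 0 (1 - (b%:~R - 1) * b%:~R * beta / (beta ^+ 2 - b%:~R ^+ 2))
        <= gamma beta,
      coprimez a b ->
        gamma beta =
        Num.max 0 (1 - (b%:~R - 1) * b%:~R * beta / (beta ^+ 2 - b%:~R ^+ 2))
    & (b%:~R - 1) * b%:~R * beta / (beta ^+ 2 - b%:~R ^+ 2) < 1
        <-> (b - 1) * b < a].
Proof.
have [_ beta_gt1 _] := beta_pisot.
have beta_gt0 : 0 < beta by rewrite (lt_trans _ beta_gt1).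
have b_gt0 : 0 < b by exact: lt_le_trans b_ge1.
have bR_gt0 : 0 < b%:~R :> R by rewrite ltr0z.
have bR_le_a : b%:~R <= a%:~R :> R by rewrite ler_int.
pose t := b%:~R / beta.
have t_beta : t * beta = b%:~R by rewrite /t divfK ?gt_eqF.
have t_gt0 : 0 < t by rewrite divr_gt0.
have betaE : beta = a%:~R + t.
  apply: (mulIf (lt0r_neq0 beta_gt0)).
  by rewrite mulrDl t_beta -expr2.
have b_lt_beta : b%:~R < beta by rewrite betaE (le_lt_trans bR_le_a) ?ltrDl.
have t_lt1 : t < 1 by rewrite ltr_pdivrMr ?mul1r.
have den_gt0 : 0 < beta ^+ 2 - b%:~R ^+ 2.
  by rewrite subr_gt0 ltr_pXn2r ?nnegrE ?ltW.
have t2 : 0 < 1 - t ^+ 2 by rewrite subr_gt0 expr_lt1// ltW.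
have -> : 1 - (b%:~R - 1) * b%:~R * beta / (beta ^+ 2 - b%:~R ^+ 2) = crit b t.
  have -> : beta ^+ 2 - b%:~R ^+ 2 = beta ^+ 2 * (1 - t ^+ 2).
    by rewrite -t_beta; ring.
  rewrite /crit -[X in _ * X * beta]t_beta; field.
  by rewrite !gt_eqF.
have normE := algnorm_quadratic beta_quadratic beta_eq b_gt0 beta_gt0.
have irr := quadratic_irrational beta_quadratic.
set M := Num.max 0 (crit b t).
have M_ge0 : 0 <= M by rewrite le_max lexx.
have M_le1 : M <= 1 by rewrite ge_max ler01 (crit_le1 b_ge1).
rewrite /gamma normE; set E := (X in sup X).
have EM : E M.
  split; first by rewrite M_ge0.
  move=> x [[p [q [q0]]]]; rewrite coprimezN => qb xE.
  rewrite /= in_itv /= => /andP[x0 xM].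
  have vE : x = value beta q (p, 0) by rewrite xE value_rat.
  have xc : x < crit b t by move: xM; rewrite /M lt_max ltNge x0.
  rewrite vE in x0 xc *.
  exact: (lt_crit_Pur b_ge1 b_le_a betaE t_beta t_gt0 t_lt1 q0 qb x0 xc).
have Eub : ubound E 1 by move=> r [/andP[]].
split.
- by apply: ub_le_sup EM; exists 1.
- move=> ab; apply/eqP; rewrite eq_le ub_le_sup ?andbT//; last by exists 1.
  apply: ge_sup; first by exists M.
  move=> r [/andP[r0 r1] Er]; rewrite leNgt; apply/negP => Mr.
  (* half of the gap for the choice of the rational, half for the error term *)
  pose h := (r - M) / 2.
  have h0 : 0 < h by rewrite divr_gt0// subr_gt0.
  have e_gt0 : 0 < orbit_bound a t + `|crit b t|.
    rewrite ltr_wpDr// ltr_wpDl// divr_ge0 ?subr_ge0 ?(ltW t_lt1)//.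
    exact: le_trans (ltW bR_gt0) bR_le_a.
  have [n hn] : exists n, t ^+ n * (orbit_bound a t + `|crit b t|) < h.
    have [n hn] := expr_lt_pos t_gt0 t_lt1 (divr_gt0 h0 e_gt0).
    by exists n; rewrite -ltr_pdivlMr.
  (* q is prime to b, and large enough for the rationals m / q with the worst
     2n digits to have gaps smaller than h *)
  pose Q := Num.bound ((b%:~R : R) ^+ n.*2 / h).
  pose q : int := 1 + b * Q.
  have q0 : 0 < q by rewrite ltr_pwDl// mulr_ge0// ltW.
  have qb : coprimez q b.
    by apply/coprimezP; exists (1, - Q%:Z); rewrite /q /=; ring.
  have hq : b%:~R ^+ n.*2 < q%:~R * (r - (M + h)).
    have -> : r - (M + h) = h by rewrite /h; lra.
    rewrite -ltr_pdivrMr// (lt_le_trans (archi_boundP _))//.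
      by rewrite divr_ge0 ?exprn_ge0// ltW.
    by rewrite pmulrn ler_int -/Q ler_wpDl// ler_peMl.
  have q_neq0 : q != 0 by rewrite gt_eqF.
  have [m [um /andP[vM vr]]] :=
    worst_dense b_ge1 b_le_a betaE t_beta t_gt0 t_lt1 q_neq0 qb ab q0 hq.
  have xP : Pur beta (value beta q (m, 0)).
    apply: Er; split.
      exists m, q; rewrite gt_eqF// coprimezN; split=> //.
      by rewrite value_rat.
    by rewrite /= in_itv /= vr (le_trans _ (ltW vM))// addr_ge0// ltW.
  have := Pur_le_upper b_ge1 b_le_a betaE t_beta t_gt0 t_lt1 q_neq0 qb irr
    n.*2 xP.
  rewrite um leNgt => /negP; apply; apply: le_lt_trans vM.
  rewrite lerD ?le_max ?lexx ?orbT// (le_trans _ (ltW hn))//.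
  rewrite ler_wpM2r ?(ltW e_gt0)// ler_wiXn2l ?(ltW t_gt0) ?(ltW t_lt1)//.
  by rewrite -addnn leq_addr.
- rewrite ltr_pdivrMr// mul1r beta_eq.
  have -> : (b%:~R - 1) * b%:~R = ((b - 1) * b)%:~R :> R by rewrite intrM intrB.
  have cE : b%:~R ^+ 2 = ((b - 1) * b)%:~R + b%:~R :> R.
    by rewrite intrM intrB; ring.
  rewrite cE; set c := (b - 1) * b.
  split=> h; last first.
    have cR : c%:~R <= a%:~R - 1 :> R.
      by rewrite -(intrB _ a 1) ler_int lerBrDr lezD1.
    have := ler_wpM2r (ltW beta_gt0) cR.
    have : c%:~R < beta by rewrite betaE; move: t_gt0 cR; lra.
    by lra.
  rewrite ltNge; apply/negP => ac.
  have cR : a%:~R <= c%:~R :> R by rewrite ler_int.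
  have := ler_wpM2r (ltW beta_gt0) cR.
  by move: h cR (lt_le_trans bR_gt0 bR_le_a); lra.
Qed.
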